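(* Let the data $y\in\mathbb{R}^n$, $X\in\mathbb{R}^{n\times p}$, $Z\in\mathbb{R}^{n\times q}$ be fixed, with $Z^TZ$ and $X^TP_ZX$ non-singular, where $P_Z=Z(Z^TZ)^{-1}Z^T$. Let $X=U_X\Sigma_XV_X^T$, $Z=U_Z\Sigma_ZV_Z^T$ be thin singular value decompositions. Let $\delta\in(0,1)$, $\varepsilon\in(0,1/3]$, and let $\Pi\in\mathbb{R}^{m\times n}$ be a countsketch matrix with $m\ge\max\{q(q+1),2pq\}/(\varepsilon^2\delta)$. Suppose $\sigma_{\min}^2(U_Z^TU_X)\ge 16\varepsilon(1+\varepsilon)/(1-\varepsilon)$ and let $\sigma^*:=[\sigma_{\min}(X)\sigma_{\min}^2(U_Z^TU_X)]^{-1}$. Then with probability at least $1-\delta$, $$\|\widetilde\beta_{2SLS}-\widehat\beta_{2SLS}\|\le\frac{4\varepsilon}{1-\varepsilon}\left[2+3\frac{\|\widehat e\|}{\sqrt p}\right]\sigma^*.$$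
   Context: $\widehat\beta_{2SLS}=(X^TP_ZX)^{-1}X^TP_Zy$, $\widehat e=y-X\widehat\beta_{2SLS}$, and $\widetilde\beta_{2SLS}=(\widetilde X^TP_{\widetilde Z}\widetilde X)^{-1}\widetilde X^TP_{\widetilde Z}\widetilde y$ with $\widetilde X=\Pi X$, $\widetilde Z=\Pi Z$, $\widetilde y=\Pi y$. Countsketch: $\Pi$ has i.i.d. columns, each with exactly one nonzero entry, in a uniformly random row, equal to $\pm1$ with equal probability. $\sigma_{\min}$ denotes the smallest singular value. *)

(* Defs.v *)
From HB Require Import structures.
From mathcomp Require Import all_boot all_order all_algebra.
From mathcomp Require Import classical_sets reals.
Set Implicit Arguments. Unset Strict Implicit. Unset Printing Implicit Defensive.
Import Order.TTheory GRing.Theory Num.Theory.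
Local Open Scope ring_scope.
Local Open Scope classical_set_scope.

Definition vnorm {R : realType} {k : nat} (v : 'cV[R]_k) : R :=
  Num.sqrt (\sum_(i < k) v i ord0 ^+ 2).

(* Smallest singular value of a (tall, k >= l) matrix A : 'M_(k,l):
   sigma_min(A) = inf { ||A x|| : ||x|| = 1 }. *)
Definition sigma_min {R : realType} {k l : nat} (A : 'M[R]_(k, l)) : R :=
  inf [set vnorm (A *m x) | x in [set x : 'cV[R]_l | vnorm x = 1]].

Definition projmx {R : realType} {n q : nat} (Z : 'M[R]_(n, q)) : 'M[R]_n :=
  Z *m invmx (Z^T *m Z) *m Z^T.

Definition tsls {R : realType} {n p q : nat}
  (X : 'M[R]_(n, p)) (Z : 'M[R]_(n, q)) (y : 'cV[R]_n) : 'cV[R]_p :=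
  invmx (X^T *m projmx Z *m X) *m X^T *m projmx Z *m y.

(* Sample space of a countsketch Pi in R^{m x n}: for every column j, a row
   h(j) in 'I_m and a sign s(j) (true = +1, false = -1); all choices
   independent and uniform, i.e. the uniform distribution on this finite type. *)
Definition cs_outcome (m n : nat) := {ffun 'I_n -> 'I_m * bool}.

Definition countsketch {R : realType} {m n : nat} (w : cs_outcome m n) : 'M[R]_(m, n) :=
  \matrix_(i < m, j < n) (if (w j).1 == i then (if (w j).2 then 1 else -1) else 0).

Definition uprob {R : realType} (T : finType) (E : pred T) : R :=
  #|[set w | E w]|%:R / #|T|%:R.

Definition thin_svd {R : realType} {k l r : nat} (A : 'M[R]_(k, l))
  (U : 'M[R]_(k, r)) (S : 'M[R]_r) (V : 'M[R]_(l, r)) : Prop :=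
  [/\ A = U *m S *m V^T, U^T *m U = 1%:M, V^T *m V = 1%:M,
      is_diag_mx S & forall i, 0 < S i i].

(* Main.v *)
Require Import Defs.
From HB Require Import structures.
From mathcomp Require Import all_boot all_order all_algebra.
From mathcomp Require Import classical_sets reals.
From mathcomp Require Import ring lra.
Import Order.TTheory GRing.Theory Num.Theory.
Local Open Scope ring_scope.
Set Implicit Arguments. Unset Strict Implicit. Unset Printing Implicit Defensive.

(** Let [W = Pi^T Pi], [G = UZ^T W UZ], [B = UZ^T W UX], [M = UZ^T UX], and split
    the residual as [e = e0 + e1] with [e0 = UZ UZ^T e].  With [u] the image of
    the estimation error under [SX VX^T], the sketched normal equation reads
    [B^T G^-1 B u = UX^T W e0 + B^T G^-1 UZ^T W e1].  The normal equation of the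
    unsketched problem says [UX^T e0 = 0], and [UZ^T e1 = 0] by construction, so
    both terms on the right are pure sketching noise.

    A countsketch satisfies
    [E |A^T W B - A^T B|_F^2 <= (|A|_F^2 |B|_F^2 + |A^T B|_F^2) / m].  A union
    bound over the deviations of [G], [B] and the two noise terms would cost a
    factor in [delta]; instead the constants leave room to allow deviations of
    [2 eps] (resp. [2 eps (|e| / sqrt p + 1/2)] for the noise terms), so that a
    single application of Markov's inequality to the weighted sum of the four
    squared deviations, whose mean is at most [3/4 delta], is enough. *)

(** * Euclidean and Frobenius norms, and matrices with orthonormal columns *)

Section InnerProduct.
Variable R : realType.

Definition dotv {k} (x y : 'cV[R]_k) : R := (x^T *m y) ord0 ord0.

Definition fro2 {k l} (A : 'M[R]_(k, l)) : R := \sum_i \sum_j A i j ^+ 2.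

Lemma dotvE k (x y : 'cV[R]_k) : dotv x y = \sum_i x i ord0 * y i ord0.
Proof. by rewrite /dotv mxE; apply: eq_bigr => i _; rewrite mxE. Qed.

Lemma dotvC k (x y : 'cV[R]_k) : dotv x y = dotv y x.
Proof. by rewrite !dotvE; apply: eq_bigr => i _; rewrite mulrC. Qed.

Lemma dotvDr k (x y z : 'cV[R]_k) : dotv x (y + z) = dotv x y + dotv x z.
Proof. by rewrite /dotv mulmxDr mxE. Qed.

Lemma dotvDl k (x y z : 'cV[R]_k) : dotv (y + z) x = dotv y x + dotv z x.
Proof. by rewrite dotvC dotvDr !(dotvC x). Qed.

Lemma dotv0 k (x : 'cV[R]_k) : dotv x 0 = 0.
Proof. by rewrite /dotv mulmx0 mxE. Qed.

Lemma dotvZr k a (x y : 'cV[R]_k) : dotv x (a *: y) = a * dotv x y.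
Proof. by rewrite /dotv -scalemxAr mxE. Qed.

Lemma dotvNr k (x y : 'cV[R]_k) : dotv x (- y) = - dotv x y.
Proof. by rewrite /dotv mulmxN mxE. Qed.

Lemma dotv_mull k l (A : 'M[R]_(k, l)) x y : dotv (A *m x) y = dotv x (A^T *m y).
Proof. by rewrite /dotv trmx_mul !mulmxA. Qed.

Lemma dotv_mulr k l (A : 'M[R]_(k, l)) x y : dotv x (A *m y) = dotv (A^T *m x) y.
Proof. by rewrite dotv_mull trmxK. Qed.

Lemma dotvv_ge0 k (x : 'cV[R]_k) : 0 <= dotv x x.
Proof. by rewrite dotvE sumr_ge0 // => i _; rewrite -expr2 sqr_ge0. Qed.

Lemma dotvv_eq0 k (x : 'cV[R]_k) : dotv x x = 0 -> x = 0.
Proof.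
rewrite dotvE => /eqP; rewrite psumr_eq0; last by move=> i _; rewrite -expr2 sqr_ge0.
move=> /allP x0; apply/matrixP => i j; rewrite (ord1 j) mxE.
by have /eqP := x0 i (mem_index_enum _); rewrite -expr2 => /eqP; rewrite sqrf_eq0 => /eqP.
Qed.

Lemma vnormE k (x : 'cV[R]_k) : vnorm x = Num.sqrt (dotv x x).
Proof. by rewrite /vnorm dotvE; congr Num.sqrt; apply: eq_bigr => i _; rewrite expr2. Qed.

Lemma sqr_vnorm k (x : 'cV[R]_k) : vnorm x ^+ 2 = dotv x x.
Proof. by rewrite vnormE sqr_sqrtr // dotvv_ge0. Qed.

Lemma vnorm_ge0 k (x : 'cV[R]_k) : 0 <= vnorm x.
Proof. by rewrite vnormE sqrtr_ge0. Qed.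

Lemma vnorm_eq0 k (x : 'cV[R]_k) : vnorm x = 0 -> x = 0.
Proof. by move=> x0; apply: dotvv_eq0; rewrite -sqr_vnorm x0 expr0n. Qed.

Lemma vnorm0 k : vnorm (0 : 'cV[R]_k) = 0.
Proof. by rewrite vnormE dotv0 sqrtr0. Qed.

Lemma vnormZ k a (x : 'cV[R]_k) : vnorm (a *: x) = `|a| * vnorm x.
Proof.
rewrite !vnormE dotvZr dotvC dotvZr mulrA -expr2 sqrtrM ?sqr_ge0 //.
by rewrite sqrtr_sqr.
Qed.

(** Lagrange's identity: twice the gap is a double sum of squares. *)
Lemma sum_CauchySchwarz (I : finType) (f g : I -> R) :
  (\sum_i f i * g i) ^+ 2 <= (\sum_i f i ^+ 2) * (\sum_i g i ^+ 2).
Proof.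
rewrite -subr_ge0 -(pmulr_rge0 _ (ltr0Sn _ 1)).
suff -> : 2 * ((\sum_i f i ^+ 2) * (\sum_i g i ^+ 2) - (\sum_i f i * g i) ^+ 2) =
  \sum_i \sum_j (f i * g j - f j * g i) ^+ 2.
  by do 2!apply: sumr_ge0 => ? _; apply: sqr_ge0.
have FG (F G : I -> R) : (\sum_i F i) * (\sum_j G j) = \sum_i \sum_j F i * G j.
  by rewrite mulr_suml; apply: eq_bigr => i _; rewrite mulr_sumr.
transitivity ((\sum_i f i ^+ 2) * (\sum_i g i ^+ 2) + (\sum_i g i ^+ 2) * (\sum_i f i ^+ 2)
  - 2 * ((\sum_i f i * g i) * (\sum_i f i * g i))); first by ring.
rewrite !FG mulr_sumr -big_split -sumrB /=; apply: eq_bigr => i _.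
rewrite mulr_sumr -big_split -sumrB /=; apply: eq_bigr => j _; ring.
Qed.

Lemma dotv_le k (x y : 'cV[R]_k) : dotv x y <= vnorm x * vnorm y.
Proof.
apply: le_trans (ler_norm _) _.
rewrite -(@ler_pXn2r _ 2) ?nnegrE ?mulr_ge0 ?vnorm_ge0 //.
rewrite real_normK ?num_real // exprMn !sqr_vnorm !dotvE.
apply: le_trans (sum_CauchySchwarz _ _) _.
by under [X in X * _]eq_bigr do rewrite expr2; under [X in _ * X]eq_bigr do rewrite expr2.
Qed.

Lemma ler_vnormD k (x y : 'cV[R]_k) : vnorm (x + y) <= vnorm x + vnorm y.
Proof.
rewrite -(@ler_pXn2r _ 2) ?nnegrE ?addr_ge0 ?vnorm_ge0 //.
rewrite sqr_vnorm dotvDr !dotvDl (dotvC y x) sqrrD !sqr_vnorm.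
have := dotv_le x y; lra.
Qed.

Lemma fro2_ge0 k l (A : 'M[R]_(k, l)) : 0 <= fro2 A.
Proof. by do 2!apply: sumr_ge0 => ? _; apply: sqr_ge0. Qed.

Lemma fro2_col k l (A : 'M[R]_(k, l)) : fro2 A = \sum_j dotv (col j A) (col j A).
Proof.
rewrite /fro2 exchange_big; apply: eq_bigr => j _ /=.
by rewrite dotvE; apply: eq_bigr => i _; rewrite !mxE expr2.
Qed.

Lemma fro2_cV k (x : 'cV[R]_k) : fro2 x = vnorm x ^+ 2.
Proof. by rewrite fro2_col big_ord1 sqr_vnorm; congr dotv; apply/matrixP=> i j; rewrite !mxE !ord1. Qed.

Lemma dotv_col k l l' (A : 'M[R]_(k, l)) (B : 'M[R]_(k, l')) i j :
  dotv (col i A) (col j B) = (A^T *m B) i j.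
Proof. by rewrite dotvE mxE; apply: eq_bigr => r _; rewrite !mxE. Qed.

(** Cauchy-Schwarz on each row. The averages below control Frobenius norms only, and this converts
    them into operator bounds. *)
Lemma vnorm_mul_fro k l (A : 'M[R]_(k, l)) x t :
  0 <= t -> fro2 A <= t ^+ 2 -> vnorm (A *m x) <= t * vnorm x.
Proof.
move=> t0 At; rewrite -(@ler_pXn2r _ 2) ?nnegrE ?mulr_ge0 ?vnorm_ge0 //.
rewrite exprMn; apply: le_trans (ler_wpM2r (sqr_ge0 _) At).
rewrite !sqr_vnorm !dotvE /fro2 mulr_suml; apply: ler_sum => i _.
rewrite mxE -expr2; apply: le_trans (sum_CauchySchwarz _ _) _.
by under [X in _ * X <= _]eq_bigr do rewrite expr2.
Qed.

Lemma vnorm_orth k l (U : 'M[R]_(k, l)) x : U^T *m U = 1%:M -> vnorm (U *m x) = vnorm x.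
Proof. by move=> U1; rewrite !vnormE dotv_mull mulmxA U1 mul1mx. Qed.

(** The remainder [r] satisfies [U^T *m r = 0], so the cross terms vanish. *)
Lemma pythagoras_orth k l (U : 'M[R]_(k, l)) x : U^T *m U = 1%:M ->
  vnorm x ^+ 2 = vnorm (U^T *m x) ^+ 2 + vnorm (x - U *m (U^T *m x)) ^+ 2.
Proof.
move=> U1; rewrite !sqr_vnorm.
set z := U^T *m x; set r := x - _.
have Ur : U^T *m r = 0 by rewrite /r mulmxBr mulmxA U1 mul1mx subrr.
have xE : x = U *m z + r by rewrite addrC subrK.
rewrite {1 2}xE; clearbody r; clearbody z; rewrite dotvDr !dotvDl (dotvC r) !dotv_mull Ur mulmxA U1 mul1mx.
by rewrite !dotv0 addr0 add0r.
Qed.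

Lemma vnorm_trorth k l (U : 'M[R]_(k, l)) x : U^T *m U = 1%:M -> vnorm (U^T *m x) <= vnorm x.
Proof.
move=> U1; rewrite -(@ler_pXn2r _ 2) ?nnegrE ?vnorm_ge0 //.
by rewrite (pythagoras_orth x U1) lerDl sqr_ge0.
Qed.

Lemma vnorm_orthC k l (U : 'M[R]_(k, l)) x : U^T *m U = 1%:M ->
  vnorm (x - U *m (U^T *m x)) <= vnorm x.
Proof.
move=> U1; rewrite -(@ler_pXn2r _ 2) ?nnegrE ?vnorm_ge0 //.
by rewrite [leRHS](pythagoras_orth x U1) lerDr sqr_ge0.
Qed.

Lemma fro2_orth k l (U : 'M[R]_(k, l)) : U^T *m U = 1%:M -> fro2 U = l%:R.
Proof.
move=> U1; rewrite fro2_col.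
under eq_bigr do rewrite dotv_col U1 mxE eqxx.
by rewrite sumr_const card_ord.
Qed.

Lemma fro2_trorth_mul k l l' (U : 'M[R]_(k, l)) (A : 'M[R]_(k, l')) :
  U^T *m U = 1%:M -> fro2 (U^T *m A) <= fro2 A.
Proof.
move=> U1; rewrite !fro2_col; apply: ler_sum => j _.
by rewrite -!sqr_vnorm (_ : col j _ = U^T *m col j A) ?ler_pXn2r ?nnegrE ?vnorm_ge0 ?vnorm_trorth // !colE mulmxA.
Qed.

(** A row of the left kernel of [A^T] is the transpose of a vector killed by [A]. Through this, norm
    estimates yield the non-singularity of the sketched matrices. *)
Lemma unitmx_inj k (A : 'M[R]_k) : (forall x : 'cV_k, A *m x = 0 -> x = 0) -> A \in unitmx.
Proof.
move=> Ainj; rewrite -unitmx_tr -row_free_unit -kermx_eq0; apply/eqP/row_matrixP => i.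
rewrite row0 -[row i _]trmxK [X in X^T]Ainj ?trmx0 //.
by rewrite -{1}[A]trmxK -trmx_mul -row_mul mulmx_ker row0 trmx0.
Qed.

End InnerProduct.

(** * The smallest singular value as the best constant in a lower norm bound *)

Section SigmaMin.
Variable R : realType.
Local Open Scope classical_set_scope.

Lemma sigma_min_le k l (A : 'M[R]_(k, l)) x : sigma_min A * vnorm x <= vnorm (A *m x).
Proof.
have [x0|x_neq0] := eqVneq (vnorm x) 0.
  by rewrite x0 mulr0 vnorm_ge0.
have xgt0 : 0 < vnorm x by rewrite lt_neqAle eq_sym x_neq0 vnorm_ge0.
rewrite -ler_pdivlMr //; apply: ge_inf.
  by exists 0 => _ [z _ <-]; apply: vnorm_ge0.
exists ((vnorm x)^-1 *: x) => /=.
  by rewrite vnormZ ger0_norm ?invr_ge0 ?vnorm_ge0 // mulVf.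
by rewrite -scalemxAr vnormZ ger0_norm ?invr_ge0 ?vnorm_ge0 // mulrC.
Qed.

Lemma unit_vector l : (0 < l)%N -> exists x : 'cV[R]_l, vnorm x = 1.
Proof.
case: l => // l _; exists (delta_mx ord0 ord0).
rewrite vnormE dotvE (bigD1 ord0) //= !mxE !eqxx mulr1 big1 ?addr0 ?sqrtr1 // => i i0.
by rewrite !mxE (negPf i0) mul0r.
Qed.

(** Positivity of [l] provides a unit vector; with none, the infimum would be that of the empty set,
    a default value unrelated to [c]. *)
Lemma lb_sigma_min k l (A : 'M[R]_(k, l)) c : (0 < l)%N ->
  (forall x, c * vnorm x <= vnorm (A *m x)) -> c <= sigma_min A.
Proof.
move=> /unit_vector[x x1] cA; apply: lb_le_inf.
  by exists (vnorm (A *m x)), x.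
by move=> _ [z /= z1 <-]; rewrite -[c]mulr1 -z1.
Qed.

End SigmaMin.

(** * Uniform averages on a finite type and Markov's inequality *)

Section Average.
Variables (R : realType) (T : finType).

Definition avg (f : T -> R) : R := (\sum_w f w) / #|T|%:R.

Lemma eq_avg f g : f =1 g -> avg f = avg g.
Proof. by move=> fg; rewrite /avg (eq_bigr g). Qed.

Lemma avgD f g : avg (fun w => f w + g w) = avg f + avg g.
Proof. by rewrite /avg big_split mulrDl. Qed.

Lemma avgZ c f : avg (fun w => c * f w) = c * avg f.
Proof. by rewrite /avg -mulr_sumr mulrA. Qed.

Lemma avg_sum (I : finType) (f : I -> T -> R) :
  avg (fun w => \sum_i f i w) = \sum_i avg (f i).
Proof. by rewrite /avg exchange_big mulr_suml. Qed.

Lemma ler_avg f g : (forall w, f w <= g w) -> avg f <= avg g.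
Proof. by move=> fg; rewrite ler_wpM2r ?invr_ge0 ?ler0n // ler_sum. Qed.

Lemma avg_cst c : (0 < #|T|)%N -> avg (fun=> c) = c.
Proof.
move=> T0; rewrite /avg (_ : \sum_(w : T) c = c * #|T|%:R); last by rewrite sumr_const mulr_natr.
by rewrite mulfK // pnatr_eq0 -lt0n.
Qed.

Lemma avg_eq0 f : (forall w, f w = 0) -> avg f = 0.
Proof. by move=> f0; rewrite /avg big1 ?mul0r. Qed.

Lemma uprobE (E : pred T) : uprob E = avg (fun w => (E w)%:R).
Proof.
rewrite /uprob /avg -sum1_card natr_sum big_mkcond /=; congr (_ / _).
apply: eq_bigr => w _; rewrite (_ : (w \in _) = E w); first by case: (E w).
by apply/idP/idP; rewrite inE.
Qed.

(** Average the pointwise inequality 1 <= 1_E + f, which holds off [E] because there f > 1. *)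
Lemma markov_compl (E : pred T) (f : T -> R) : (0 < #|T|)%N ->
  (forall w, 0 <= f w) -> (forall w, f w <= 1 -> E w) -> 1 - avg f <= uprob E.
Proof.
move=> T0 f0 fE; rewrite uprobE lerBlDr -avgD -[leLHS](avg_cst 1 T0).
apply: ler_avg => w; have := f0 w; have := fE w.
by case: (leP (f w) 1) => [? /(_ isT) ->|? _ _]; case: (E w) => /=; lra.
Qed.

End Average.

Lemma sum_pair (R : realType) (I J : finType) (f : I * J -> R) :
  \sum_x f x = \sum_i \sum_j f (i, j).
Proof. by rewrite pair_bigA; apply: eq_bigr => -[]. Qed.

(** * Independence of coordinates, by redrawing one of them *)

Section Resampling.
Variables (R : realType) (I A : finType).

Definition upd (w : {ffun I -> A}) (j : I) (x : A) : {ffun I -> A} :=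
  [ffun i => if i == j then x else w i].

Lemma updE w j x i : upd w j x i = if i == j then x else w i.
Proof. by rewrite ffunE. Qed.

(** Exchanging the value of [w] at [j] with a fresh [x] is an involution on pairs [(w, x)], so it
    preserves the uniform average over pairs. *)
Lemma avg_resample (f : {ffun I -> A} -> R) j : (0 < #|A|)%N ->
  avg f = avg (fun w => avg (fun x => f (upd w j x))).
Proof.
move=> A0; rewrite /avg -mulr_suml; congr (_ / _).
apply: (@mulIf _ #|A|%:R); first by rewrite pnatr_eq0 -lt0n.
rewrite divfK ?pnatr_eq0 -?lt0n // mulr_suml.
under eq_bigr do rewrite mulr_natr -sumr_const.
rewrite !pair_big /=.
rewrite (reindex_inj (h := fun u => (upd u.1 j u.2, u.1 j))) //=.
apply: (can_inj (g := fun u => (upd u.1 j u.2, u.1 j))) => -[w x] /=.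
rewrite updE eqxx; congr pair; apply/ffunP => i; rewrite !updE.
by case: eqP => // ->.
Qed.

End Resampling.

(** * Second moments of the Gram matrix of a countsketch *)

Section Countsketch.
Variables (R : realType) (m n : nat).
Hypothesis m_gt0 : (0 < m)%N.
Implicit Types (w : cs_outcome m n) (j k l r : 'I_n).

Definition sgnb (b : bool) : R := if b then 1 else -1.

Lemma sgnb_sqr b : sgnb b * sgnb b = 1.
Proof. by case: b; rewrite /= ?mulrNN mulr1. Qed.

(** The off-diagonal part of [Pi^T Pi]; the factor [(j != k)%:R] lets sums run over all pairs of
    indices. *)
Definition xi w j k : R :=
  (j != k)%:R * (sgnb (w j).2 * sgnb (w k).2 * ((w j).1 == (w k).1)%:R).

Lemma xiC w j k : xi w j k = xi w k j.
Proof. by rewrite /xi eq_sym [(w j).1 == _]eq_sym [sgnb (w j).2 * _]mulrC. Qed.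

Lemma countsketch_gram w j k :
  ((countsketch w)^T *m countsketch w) j k = (j == k)%:R + xi w j k :> R.
Proof.
rewrite mxE (bigD1 (w j).1) //= big1 => [|i]; rewrite !mxE; last first.
  by rewrite eq_sym => /negPf->; rewrite mul0r.
rewrite eqxx addr0 -!/(sgnb _) /xi.
have [->|jk] := eqVneq j k; first by rewrite eqxx sgnb_sqr mul0r addr0.
rewrite add0r mul1r [(w k).1 == _]eq_sym.
by case: eqP => _; rewrite ?mulr0 ?mulr1.
Qed.

Lemma card_cs_cell : #|{: 'I_m * bool}| = (m * 2)%N.
Proof. by rewrite card_prod card_ord card_bool. Qed.

Lemma card_cs_cell_gt0 : (0 < #|{: 'I_m * bool}|)%N.
Proof. by rewrite card_cs_cell muln_gt0 m_gt0. Qed.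

Lemma card_cs_gt0 : (0 < #|{: cs_outcome m n}|)%N.
Proof. by rewrite card_ffun expn_gt0 card_cs_cell_gt0. Qed.

(** If [j] differs from [k], the sign of column [j] enters exactly once, and redrawing that column
    cancels the two signs; if [j] equals [k], the product is already zero. *)
Lemma avg_xi_xi0 j k l r : j != l -> j != r -> avg (fun w => xi w j k * xi w l r) = 0.
Proof.
move=> jl jr; rewrite (avg_resample _ j card_cs_cell_gt0).
apply: avg_eq0 => w; rewrite /avg; apply/eqP; rewrite mulf_eq0; apply/orP; left; apply/eqP.
rewrite sum_pair.
apply: big1 => a _; rewrite big_bool /xi !updE eqxx.
rewrite (eq_sym l j) (eq_sym r j) (negPf jl) (negPf jr) (eq_sym k j).
by have [|jk] := eqVneq j k; rewrite /= ?mul0r ?addr0 //; ring.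
Qed.

(** The signs square to 1, leaving the probability that a redrawn column [j] lands in the row of
    column [k]. *)
Lemma avg_xi_sqr j k : j != k -> avg (fun w => xi w j k * xi w j k) = m%:R^-1.
Proof.
move=> jk; rewrite (avg_resample _ j card_cs_cell_gt0).
rewrite -[RHS](avg_cst _ card_cs_gt0); apply: eq_avg => w.
rewrite /avg card_cs_cell.
rewrite sum_pair.
rewrite (bigD1 (w k).1) //= [X in _ + X]big1 => [|i ik].
  rewrite big_bool /xi !updE eqxx (eq_sym k) (negPf jk) /= eqxx.
  have m0 : m%:R != 0 :> R by rewrite pnatr_eq0 -lt0n.
  rewrite natrM; case: (w k).2 => /=; field; exact: m0.
rewrite big_bool /xi !updE eqxx (eq_sym k) (negPf jk) /= (negPf ik) /=.
by rewrite !mulr0 addr0.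
Qed.

(** Unless the pairs {j, k} and {l, r} coincide, [j] or [k] is missing from the second pair and
    [avg_xi_xi0] applies, up to the symmetry of [xi]. *)
Lemma avg_xi_xi j k l r : avg (fun w => xi w j k * xi w l r) =
  (j != k)%:R * (((l == j) && (r == k))%:R + ((l == k) && (r == j))%:R) / m%:R.
Proof.
have [->|jk] := eqVneq j k.
  rewrite /= !mul0r; apply: avg_eq0 => w; by rewrite /xi eqxx !mul0r.
rewrite mul1r.
have [->|lr] := eqVneq l r.
  rewrite (_ : avg _ = 0); last first.
    apply: avg_eq0 => w; by rewrite /xi eqxx !(mul0r, mulr0).
  have [->|_] := eqVneq r j; first by rewrite (negPf jk) addr0 mul0r.
  by rewrite andbF addr0 mul0r.
have [->|lj] := eqVneq l j.
  have [->|rk] := eqVneq r k.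
    by rewrite (negPf jk) addr0 mul1r avg_xi_sqr.
  rewrite (negPf jk) addr0 mul0r.
  rewrite -[RHS](@avg_xi_xi0 k j j r); rewrite ?(eq_sym k) ?jk //.
  by apply: eq_avg => w; rewrite xiC.
rewrite add0r.
have [->|rj] := eqVneq r j.
  have [->|lk] := eqVneq l k.
    by rewrite mul1r -(avg_xi_sqr jk); apply: eq_avg => w; rewrite (xiC w k).
  rewrite mul0r -[RHS](@avg_xi_xi0 k j l j); rewrite ?(eq_sym k) ?jk //.
  by apply: eq_avg => w; rewrite xiC.
by rewrite andbF mul0r avg_xi_xi0 // eq_sym.
Qed.

Lemma avg_xi_form_sqr (a b : 'I_n -> R) :
  avg (fun w => (\sum_j \sum_k a j * b k * xi w j k) ^+ 2) <=
  ((\sum_j a j ^+ 2) * (\sum_j b j ^+ 2) + (\sum_j a j * b j) ^+ 2) / m%:R.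
Proof.
have -> : avg (fun w => (\sum_j \sum_k a j * b k * xi w j k) ^+ 2) =
   \sum_j \sum_k (j != k)%:R * ((a j * b k) ^+ 2 + a j * b j * (a k * b k)) / m%:R.
  transitivity (\sum_j \sum_k \sum_l \sum_r
     (a j * b k) * (a l * b r) * avg (fun w => xi w j k * xi w l r)).
    under eq_avg => w.
      rewrite expr2 mulr_suml.
      under eq_bigr => j _.
        rewrite mulr_suml.
        under eq_bigr => k _.
          rewrite mulr_sumr.
          under eq_bigr => l _.
            rewrite mulr_sumr.
            under eq_bigr => r _ do rewrite mulrACA.
          over.
        over.
      over.
    over.
    rewrite avg_sum; apply: eq_bigr => j _.
    rewrite avg_sum; apply: eq_bigr => k _.
    rewrite avg_sum; apply: eq_bigr => l _.
    rewrite avg_sum; apply: eq_bigr => r _.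
    by rewrite avgZ.
  apply: eq_bigr => j _; apply: eq_bigr => k _.
  under eq_bigr => l _ do under eq_bigr => r _ do rewrite avg_xi_xi.
  have [->|jk] := eqVneq j k.
    by rewrite !mul0r big1 // => l _; rewrite big1 // => r _; rewrite !(mul0r, mulr0).
  (* In the sum over [l] and [r], only (j, k) and (k, j) survive. *)
  rewrite (bigD1 j) //= [X in _ + X](bigD1 k) /=; last by rewrite eq_sym.
  rewrite [X in _ + (_ + X)]big1 ?addr0; last first.
    move=> l /andP[lj lk]; rewrite big1 // => r _.
    by rewrite (negPf lj) (negPf lk) addr0 mulr0 mul0r mulr0.
  rewrite (bigD1 k) //= [X in _ + X + _]big1 ?addr0; last first.
    by move=> r rk; rewrite (negPf rk) (negPf jk) andbF addr0 mulr0 mul0r mulr0.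
  rewrite (bigD1 j) //= [X in _ + (_ + X)]big1 ?addr0; last first.
    by move=> r rj; rewrite (negPf rj) (eq_sym k) (negPf jk) andbF addr0 mulr0 mul0r mulr0.
  rewrite !eqxx (eq_sym k) (negPf jk) /=; ring.
rewrite expr2.
have FG (F G : 'I_n -> R) : (\sum_i F i) * (\sum_j G j) = \sum_i \sum_j F i * G j.
  by rewrite mulr_suml; apply: eq_bigr => i _; rewrite mulr_sumr.
rewrite !FG -big_split mulr_suml /=; apply: ler_sum => j _.
rewrite -big_split mulr_suml /=; apply: ler_sum => k _.
rewrite ler_wpM2r ?invr_ge0 ?ler0n //.
(* The only loss is on the diagonal, where the left side is zero and the right side is a sum of
   nonnegative terms. *)
have [->|jk] := eqVneq j k; last by rewrite mul1r exprMn.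
rewrite mul0r; apply: addr_ge0; first by apply: mulr_ge0; apply: sqr_ge0.
by rewrite -expr2; apply: sqr_ge0.
Qed.

End Countsketch.

(** The identity part of [Pi^T Pi] reproduces [A^T *m B], so each entry of the deviation is a
    bilinear form in [xi]; the bound for one form is summed over all entries. *)
Lemma avg_sketch_fro2 (R : realType) m n k l (A : 'M[R]_(n, k)) (B : 'M[R]_(n, l)) : (0 < m)%N ->
  avg (fun w : cs_outcome m n =>
    fro2 (A^T *m ((countsketch w)^T *m countsketch w) *m B - A^T *m B)) <=
  (fro2 A * fro2 B + fro2 (A^T *m B)) / m%:R.
Proof.
move=> m0; rewrite /fro2 avg_sum.
have -> : (\sum_i \sum_j A i j ^+ 2) * (\sum_i \sum_j B i j ^+ 2) +
   \sum_i \sum_j (A^T *m B) i j ^+ 2 =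
   \sum_(i < k) \sum_(j < l) ((\sum_r A r i ^+ 2) * (\sum_r B r j ^+ 2) +
      (\sum_r A r i * B r j) ^+ 2).
  rewrite exchange_big /= [X in _ * X + _]exchange_big /= mulr_suml -big_split /=.
  apply: eq_bigr => i _; rewrite mulr_sumr -big_split /=; apply: eq_bigr => j _.
  by congr (_ + _ ^+ 2); rewrite mxE; apply: eq_bigr => r _; rewrite mxE.
rewrite mulr_suml; apply: ler_sum => i _; rewrite avg_sum mulr_suml; apply: ler_sum => j _.
apply: le_trans (avg_xi_form_sqr m0 (fun r => A r i) (fun r => B r j)).
rewrite le_eqVlt; apply/orP; left; apply/eqP; apply: eq_avg => w; congr (_ ^+ 2).
rewrite -mulmxA !mxE -sumrB; apply: eq_bigr => r _.
rewrite !mxE -mulrBr.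
transitivity (A r i * \sum_s xi R w r s * B s j); last first.
  by rewrite mulr_sumr; apply: eq_bigr => s _; ring.
congr (_ * _); under eq_bigr => s _ do rewrite countsketch_gram mulrDl.
rewrite big_split /= (bigD1 r) //= eqxx mul1r big1 => [|s /negPf]; first by ring.
by rewrite eq_sym => ->; rewrite mul0r.
Qed.

(** * Algebra of the 2SLS estimator and deterministic perturbation bounds *)

Section TwoStageLeastSquares.
Variable R : realType.

(** The projection depends on the column space alone. This removes the singular values of the
    instruments, before and after sketching. *)
Lemma projmx_mulr n q (Z : 'M[R]_(n, q)) (T : 'M[R]_q) :
  T \in unitmx -> Z^T *m Z \in unitmx -> projmx (Z *m T) = projmx Z.
Proof.
move=> Tu Zu; have Ttu : T^T \in unitmx by rewrite unitmx_tr.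
have inv2 (A B : 'M[R]_q) : A \in unitmx -> B \in unitmx ->
    invmx (A *m B) = invmx B *m invmx A.
  move=> Au Bu; apply: (can_inj (mulKmx (_ : A *m B \in unitmx))).
    by rewrite unitmx_mul Au.
  by rewrite mulmxV ?unitmx_mul ?Au // mulmxA -(mulmxA A) mulmxV // mulmx1 mulmxV.
rewrite /projmx trmx_mul -!mulmxA (mulmxA Z^T) inv2 ?unitmx_mul ?Zu //.
rewrite inv2 // -!mulmxA (mulmxA (invmx T^T)) mulVmx // mul1mx.
by rewrite (mulmxA T) mulmxV // mul1mx.
Qed.

(** The free [b] serves two uses: the estimator itself, giving orthogonality of the residual, and
    the unsketched estimator inside the sketched problem. *)
Lemma tsls_normal_eq n p q (X : 'M[R]_(n, p)) (Z : 'M[R]_(n, q)) y b :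
  X^T *m projmx Z *m X \in unitmx ->
  X^T *m projmx Z *m X *m (tsls X Z y - b) = X^T *m projmx Z *m (y - X *m b).
Proof.
move=> Nu; rewrite (_ : tsls X Z y = invmx (X^T *m projmx Z *m X) *m (X^T *m projmx Z *m y)).
  by rewrite mulmxBr mulKVmx // mulmxBr !mulmxA.
by rewrite /tsls !mulmxA.
Qed.

Lemma tsls_orthogonal n p q (X : 'M[R]_(n, p)) (Z : 'M[R]_(n, q)) y :
  X^T *m projmx Z *m X \in unitmx -> X^T *m projmx Z *m (y - X *m tsls X Z y) = 0.
Proof. by move=> Nu; rewrite -tsls_normal_eq // subrr mulmx0. Qed.

(** Puts the decomposition in the form used below: orthonormal columns times an invertible square
    factor. A positive diagonal makes [S] injective, and [V] is square here. *)
Lemma thin_svd_unit k r (A U : 'M[R]_(k, r)) S (V : 'M_r) :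
  thin_svd A U S V ->
  [/\ A = U *m (S *m V^T), U^T *m U = 1%:M & S *m V^T \in unitmx].
Proof.
case=> AE U1 V1 /is_diag_mxP Sd S0; rewrite mulmxA; split=> //.
rewrite unitmx_mul unitmx_tr (mulmx1_unit V1).2 andbT.
apply: unitmx_inj => x Sx0; apply/matrixP => i j.
move: (congr1 (fun M : 'cV_r => M i j) Sx0); rewrite !mxE (bigD1 i) //= big1.
  by rewrite addr0 => /eqP; rewrite mulf_eq0 gt_eqF //= => /eqP.
by move=> l li; rewrite Sd ?mul0r // eq_sym.
Qed.

(** Write x = T^-1 (T x). With F the squared Frobenius norm of T^-1, F <= (1 + F)^2, so 1 + F bounds
    the operator norm without a square root and is never zero. *)
Lemma sigma_min_gt0 k r (U : 'M[R]_(k, r)) (T : 'M_r) : (0 < r)%N ->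
  U^T *m U = 1%:M -> T \in unitmx -> 0 < sigma_min (U *m T).
Proof.
move=> r0 U1 Tu; set c := (1 + fro2 (invmx T))^-1.
have c1 : 0 < 1 + fro2 (invmx T) by have := fro2_ge0 (invmx T); lra.
apply: (@lt_le_trans _ _ c); first by rewrite invr_gt0.
apply: lb_sigma_min => // x; rewrite -mulmxA vnorm_orth //.
rewrite /c ler_pdivrMl //.
rewrite -{1}[x](mulKmx Tu); apply: vnorm_mul_fro; first exact: ltW.
by have := fro2_ge0 (invmx T); nra.
Qed.

(* With v = G^-1 B u, pairing the equation with u gives <v, G v> = <u, f> + <v, g>. *)
Lemma perturbed_normal_eq p q (G : 'M[R]_q) (M B : 'M[R]_(q, p)) (u : 'cV_p)
    (f : 'cV_p) (g : 'cV_q) (t s tau : R) :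
  0 <= t -> t <= 1 / 8 -> 8 * t <= s -> s <= 1 ->
  G^T = G -> G \in unitmx ->
  fro2 (G - 1%:M) <= t ^+ 2 -> fro2 (B - M) <= t ^+ 2 ->
  (forall x, s * vnorm x <= vnorm (M *m x)) ->
  B^T *m invmx G *m B *m u = f + B^T *m invmx G *m g ->
  vnorm f <= tau -> vnorm g <= tau ->
  s ^+ 2 * vnorm u <= 7 / 2 * tau.
Proof.
move=> t0 t8 ts s1 Gs Gu Gt Bt sM Nu fa ga.
set v := invmx G *m (B *m u).
have GV : G *m v = B *m u by rewrite mulKVmx.
have u0 := vnorm_ge0 u; have v0 := vnorm_ge0 v.
have vG : vnorm (G *m v - v) <= t * vnorm v.
  by rewrite -{2}[v]mul1mx -mulmxBl; apply: vnorm_mul_fro.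
have w_le : vnorm (B *m u) <= (1 + t) * vnorm v.
  rewrite -GV -[G *m v](subrK v); apply: le_trans (ler_vnormD _ _) _; lra.
have w_ge : s * vnorm u - t * vnorm u <= vnorm (B *m u).
  have := sM u; have : vnorm ((M - B) *m u) <= t * vnorm u.
    apply: vnorm_mul_fro => //; rewrite (_ : fro2 _ = fro2 (B - M)) //.
    by apply: eq_bigr => i _; apply: eq_bigr => j _; rewrite !mxE -sqrrN opprB.
  have := ler_vnormD (B *m u) ((M - B) *m u).
  by rewrite -mulmxDl addrC subrK; lra.
have energy : dotv v (G *m v) = dotv u f + dotv v g.
  have -> : dotv v (G *m v) = dotv u (B^T *m invmx G *m B *m u).
    by rewrite GV dotvC dotv_mull /v !mulmxA.
  rewrite Nu dotvDr; congr (_ + _).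
  by rewrite -mulmxA dotv_mulr trmxK dotv_mulr trmx_inv Gs.
(* Coercivity: [G] is within [t] of the identity, so <v, G v> >= (1 - t) |v|^2. *)
have v_le : (1 - t) * vnorm v ^+ 2 <= vnorm u * vnorm f + vnorm v * vnorm g.
  have := dotv_le u f; have := dotv_le v g; have := dotv_le v (v - G *m v).
  have : vnorm (v - G *m v) <= t * vnorm v.
    by rewrite -[v - _]opprB -scaleN1r vnormZ normrN1 mul1r.
  move=> h1 h2; rewrite dotvDr dotvNr energy -sqr_vnorm in h2 *.
  have := ler_wpM2l v0 h1; nra.
have f0 := vnorm_ge0 f; have g0 := vnorm_ge0 g.
have tau0 : 0 <= tau by lra.
(* From s - t >= 7/8 s and 1 + t <= 9/8. *)
have su : 7 / 8 * s * vnorm u <= 9 / 8 * vnorm v by nra.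
(* Multiply [v_le] by [s] and eliminate s |u| through [su]; 9/7 is the ratio of 9/8 to 7/8. *)
have sv : 7 / 8 * s * vnorm v ^+ 2 <= vnorm v * (9 / 7 * tau + s * tau).
  have : s * (vnorm u * vnorm f) <= 9 / 7 * vnorm v * tau.
    apply: (@le_trans _ _ ((s * vnorm u) * tau)); last by nra.
    by rewrite mulrA ler_wpM2l // mulr_ge0 //; lra.
  have : s * (vnorm v * vnorm g) <= s * (vnorm v * tau).
    by rewrite ler_wpM2l ?ler_wpM2l //; lra.
  have : 7 / 8 * s * vnorm v ^+ 2 <= s * ((1 - t) * vnorm v ^+ 2).
    rewrite [leRHS]mulrA; apply: ler_wpM2r; [exact: sqr_ge0|nra].
  have : s * ((1 - t) * vnorm v ^+ 2) <= s * (vnorm u * vnorm f + vnorm v * vnorm g).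
    by rewrite ler_wpM2l //; lra.
  nra.
have sv' : 7 / 8 * s * vnorm v <= 16 / 7 * tau.
  have [->|vn0] := eqVneq (vnorm v) 0; first by rewrite mulr0; lra.
  rewrite -(@ler_pM2l _ (vnorm v)); last by rewrite lt_neqAle eq_sym vn0.
  have st : s * tau <= tau by nra.
  have := ler_wpM2l v0 st; nra.
have s0 : 0 <= s by lra.
(* Chaining [su] and [sv']: 9/7 * 8/7 * 16/7 = 1152/343 < 7/2. *)
nra.
Qed.

End TwoStageLeastSquares.

(** The normal equation of the unsketched problem, with P_Z = UZ UZ^T and the invertible [TX^T]
    cancelled. *)
Lemma tsls_orthogonal_factor (R : realType) n p q (y : 'cV[R]_n)
    (X UX : 'M[R]_(n, p)) (Z UZ : 'M[R]_(n, q)) (TX : 'M_p) (TZ : 'M_q) :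
  X = UX *m TX -> TX \in unitmx -> Z = UZ *m TZ -> UZ^T *m UZ = 1%:M -> TZ \in unitmx ->
  X^T *m projmx Z *m X \in unitmx ->
  UX^T *m (UZ *m (UZ^T *m (y - X *m tsls X Z y))) = 0.
Proof.
move=> XE TXu ZE UZ1 TZu Nu; have := tsls_orthogonal y Nu.
set e := y - _; rewrite XE trmx_mul.
have -> : projmx Z = UZ *m UZ^T.
  by rewrite ZE projmx_mulr ?UZ1 ?unitmx1 // /projmx UZ1 invmx1 mulmx1.
rewrite -!mulmxA => /(congr1 (mulmx (invmx TX^T))).
by rewrite mulKmx ?unitmx_tr // mulmx0.
Qed.

(** The deterministic half: any sketch with these four small deviations is good. After [TX] and [TZ]
    are factored out, [perturbed_normal_eq] applies with t = 2 eps. *)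
Lemma sketched_tsls_error (R : realType) n p q m (y : 'cV[R]_n)
    (X UX : 'M[R]_(n, p)) (Z UZ : 'M[R]_(n, q)) (TX : 'M_p) (TZ : 'M_q)
    (Pi : 'M[R]_(m, n)) (s eps tau : R) :
  let e := y - X *m tsls X Z y in
  let e0 := UZ *m (UZ^T *m e) in
  X = UX *m TX -> UX^T *m UX = 1%:M -> TX \in unitmx ->
  Z = UZ *m TZ -> UZ^T *m UZ = 1%:M -> TZ \in unitmx ->
  X^T *m projmx Z *m X \in unitmx ->
  0 < eps -> 16 * eps <= s -> s <= 1 -> 0 <= tau ->
  (forall x, s * vnorm x <= vnorm (UZ^T *m UX *m x)) ->
  fro2 (UZ^T *m (Pi^T *m Pi) *m UZ - UZ^T *m UZ) <= (2 * eps) ^+ 2 ->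
  fro2 (UZ^T *m (Pi^T *m Pi) *m UX - UZ^T *m UX) <= (2 * eps) ^+ 2 ->
  fro2 (UZ^T *m (Pi^T *m Pi) *m (e - e0) - UZ^T *m (e - e0)) <= (2 * eps * tau) ^+ 2 ->
  fro2 (UX^T *m (Pi^T *m Pi) *m e0 - UX^T *m e0) <= (2 * eps * tau) ^+ 2 ->
  let Xt := Pi *m X in let Zt := Pi *m Z in
  [/\ Zt^T *m Zt \in unitmx, Xt^T *m projmx Zt *m Xt \in unitmx &
    s ^+ 2 * (sigma_min X * vnorm (tsls Xt Zt (Pi *m y) - tsls X Z y)) <= 7 * eps * tau].
Proof.
move=> e e0 XE UX1 TXu ZE UZ1 TZu Nu eps0 epss s1 tau0 sM E1 E2 E3 E4 Xt Zt.
pose G := (Pi *m UZ)^T *m (Pi *m UZ); pose B := (Pi *m UZ)^T *m (Pi *m UX).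
have GE : UZ^T *m (Pi^T *m Pi) *m UZ = G by rewrite /G trmx_mul !mulmxA.
have BE : UZ^T *m (Pi^T *m Pi) *m UX = B by rewrite /B trmx_mul !mulmxA.
rewrite GE UZ1 in E1; rewrite BE in E2.
have BT : B^T = (Pi *m UX)^T *m (Pi *m UZ) by rewrite /B trmx_mul trmxK.
have Gs : G^T = G by rewrite /G trmx_mul trmxK.
(* If G x = 0 then |x| = |(G - 1) x| <= 2 eps |x|, and 2 eps < 1. *)
have Gu : G \in unitmx.
  apply: unitmx_inj => x Gx; apply: vnorm_eq0.
  have : vnorm ((G - 1%:M) *m x) <= 2 * eps * vnorm x by apply: vnorm_mul_fro; lra.
  rewrite mulmxBl Gx mul1mx sub0r -scaleN1r vnormZ normrN1 mul1r.
  by have := vnorm_ge0 x; nra.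
have TXtu : TX^T \in unitmx by rewrite unitmx_tr.
have UZu : UZ^T *m UZ \in unitmx by rewrite UZ1 unitmx1.
have ZtE : Zt = Pi *m UZ *m TZ by rewrite /Zt ZE mulmxA.
have XtE : Xt = Pi *m UX *m TX by rewrite /Xt XE mulmxA.
have PE : projmx Zt = Pi *m UZ *m invmx G *m (Pi *m UZ)^T by rewrite ZtE projmx_mulr.
have XPE : Xt^T *m projmx Zt = TX^T *m (B^T *m invmx G *m (Pi *m UZ)^T).
  by rewrite XtE PE (trmx_mul (Pi *m UX)) BT !mulmxA.
have NE : Xt^T *m projmx Zt *m Xt = TX^T *m (B^T *m invmx G *m B) *m TX.
  by rewrite XPE XtE /B !mulmxA.
(* Injectivity is the perturbation bound itself with zero right-hand side and [tau] = 0. *)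
have Bu : B^T *m invmx G *m B \in unitmx.
  apply: unitmx_inj => u Bu0; apply: vnorm_eq0.
  have := @perturbed_normal_eq _ _ _ G (UZ^T *m UX) B u 0 0 (2 * eps) s 0.
  rewrite mulmx0 add0r !vnorm0 mulr0 => H.
  have {}H : s ^+ 2 * vnorm u <= 0 by apply: H => //; lra.
  have s2 : 0 < s ^+ 2 by rewrite exprn_gt0 //; lra.
  by apply/eqP; rewrite eq_le vnorm_ge0 andbT -(pmulr_rle0 _ s2).
have Ntu : Xt^T *m projmx Zt *m Xt \in unitmx.
  by rewrite NE !unitmx_mul TXtu Bu TXu.
split=> //.
  have -> : Zt^T *m Zt = TZ^T *m G *m TZ by rewrite ZtE (trmx_mul (Pi *m UZ)) /G !mulmxA.
  by rewrite !unitmx_mul unitmx_tr TZu Gu.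
set d := tsls _ _ _ - _; set u := TX *m d.
have norm_d : sigma_min X * vnorm d <= vnorm u.
  by apply: le_trans (sigma_min_le _ _) _; rewrite XE -mulmxA vnorm_orth.
have MTe0 : UX^T *m e0 = 0 by exact: (tsls_orthogonal_factor y XE TXu ZE UZ1 TZu Nu).
have UZe' : UZ^T *m (e - e0) = 0 by rewrite mulmxBr /e0 (mulmxA UZ^T UZ) UZ1 mul1mx subrr.
rewrite MTe0 subr0 fro2_cV in E4; rewrite UZe' subr0 fro2_cV in E3.
have et0 : 0 <= 2 * eps * tau by apply: mulr_ge0; lra.
rewrite ler_pXn2r ?nnegrE ?vnorm_ge0 // in E3.
rewrite ler_pXn2r ?nnegrE ?vnorm_ge0 // in E4.
have normal_eq : B^T *m invmx G *m B *m u =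
   UX^T *m (Pi^T *m Pi) *m e0 + B^T *m invmx G *m (UZ^T *m (Pi^T *m Pi) *m (e - e0)).
  have := tsls_normal_eq (Pi *m y) (tsls X Z y) Ntu.
  have -> : Pi *m y - Xt *m tsls X Z y = Pi *m e by rewrite /e mulmxBr !mulmxA.
  rewrite -/d NE XPE -!mulmxA => /(congr1 (mulmx (invmx TX^T))); rewrite !mulKmx //.
  rewrite -/u => ->.
  (* Since [e0] lies in the range of [UZ], the sketched first stage reproduces it exactly, which
     leaves UX^T W e0. *)
  have Uz z : invmx G *m ((Pi *m UZ)^T *m (Pi *m (UZ *m z))) = z.
    by rewrite (mulmxA Pi) (mulmxA _ (Pi *m UZ)) mulKmx.
  have BU z : B^T *m z = UX^T *m (Pi^T *m Pi *m (UZ *m z)) by rewrite BT trmx_mul !mulmxA.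
  have UzE x : (Pi *m UZ)^T *m (Pi *m x) = UZ^T *m (Pi^T *m Pi *m x).
    by rewrite trmx_mul !mulmxA.
  have -> : e = e0 + (e - e0) by rewrite addrC subrK.
  move: (e - e0) => r; rewrite [e0 + r - e0]addrAC subrr add0r !mulmxDr Uz BU UzE.
  by rewrite !mulmxA.
have H : s ^+ 2 * vnorm u <= 7 / 2 * (2 * eps * tau).
  by apply: (@perturbed_normal_eq _ _ _ G (UZ^T *m UX) B u _ _ (2 * eps) s) normal_eq _ _ => //; lra.
apply: le_trans (_ : s ^+ 2 * vnorm u <= _); last by lra.
by rewrite ler_wpM2l // sqr_ge0.
Qed.

(** * Means of the four deviations, their weights, and the probability bound *)

Theorem theoremB1 (R : realType) (n p q m : nat)
  (y : 'cV[R]_n) (X : 'M[R]_(n, p)) (Z : 'M[R]_(n, q))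
  (UX : 'M[R]_(n, p)) (SX : 'M[R]_p) (VX : 'M[R]_(p, p))
  (UZ : 'M[R]_(n, q)) (SZ : 'M[R]_q) (VZ : 'M[R]_(q, q))
  (delta eps : R) :
  (0 < p)%N ->
  (Z^T *m Z) \in unitmx ->
  (X^T *m projmx Z *m X) \in unitmx ->
  thin_svd X UX SX VX ->
  thin_svd Z UZ SZ VZ ->
  0 < delta < 1 ->
  0 < eps <= 1 / 3 ->
  (maxn (q * q.+1) (2 * p * q))%:R / (eps ^+ 2 * delta) <= m%:R ->
  16 * eps * (1 + eps) / (1 - eps) <= sigma_min (UZ^T *m UX) ^+ 2 ->
  let sigma_star := (sigma_min X * sigma_min (UZ^T *m UX) ^+ 2)^-1 in
  let bhat := tsls X Z y in
  let ehat := y - X *m bhat in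
  1 - delta <=
  uprob (fun w : cs_outcome m n =>
    let Pi : 'M[R]_(m, n) := countsketch w in
    let Xt := Pi *m X in
    let Zt := Pi *m Z in
    let yt := Pi *m y in
    [&& (Zt^T *m Zt) \in unitmx,
        (Xt^T *m projmx Zt *m Xt) \in unitmx &
        vnorm (tsls Xt Zt yt - bhat)
          <= 4 * eps / (1 - eps) * (2 + 3 * (vnorm ehat / Num.sqrt p%:R)) * sigma_star]).
Proof.
move=> p0 _ Nu /thin_svd_unit[XE UX1 TXu] /thin_svd_unit[ZE UZ1 TZu].
move=> /andP[delta0 delta1] /andP[eps0 eps3] m_ge sM; lazy zeta.
set s := sigma_min (UZ^T *m UX) in sM *; set ehat := y - X *m tsls X Z y.
(* The invertible p by p matrix X^T P_Z X factors through dimension [q]. *)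
have pq : (p <= q)%N.
  rewrite -[p](mxrank_unit Nu) /projmx -!mulmxA (mulmxA X^T).
  exact: mulmx_max_rank.
have q0 : (0 < q)%N := leq_trans p0 pq.
have c0 : 0 < eps ^+ 2 * delta by rewrite mulr_gt0 ?exprn_gt0.
rewrite ler_pdivrMr // in m_ge.
have m_ge1 : (q * q.+1)%:R <= m%:R * (eps ^+ 2 * delta).
  by apply: le_trans m_ge; rewrite ler_nat leq_maxl.
have m_ge2 : (2 * p * q)%:R <= m%:R * (eps ^+ 2 * delta).
  by apply: le_trans m_ge; rewrite ler_nat leq_maxr.
have m0 : (0 < m)%N.
  case: (posnP m) m_ge1 => // ->; rewrite mul0r lern0 muln_eq0 /= orbF => /eqP q00.
  by rewrite q00 in q0.
have m0R : 0 < m%:R :> R by rewrite ltr0n.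
have s_le x := sigma_min_le (UZ^T *m UX) x; rewrite -/s in s_le.
have s_ge0 : 0 <= s by apply: lb_sigma_min => // x; rewrite mul0r vnorm_ge0.
have s1 : s <= 1.
  have [x x1] := unit_vector R p0; have := s_le x; rewrite x1 mulr1 => /le_trans; apply.
  by rewrite -x1 -mulmxA -(vnorm_orth x UX1); apply: vnorm_trorth.
(* As (1 + eps) / (1 - eps) >= 1 and 0 <= s <= 1, 16 eps <= s^2 <= s. *)
have s16 : 16 * eps <= s.
  have : 16 * eps <= s ^+ 2.
    by apply: le_trans sM; rewrite ler_pdivlMr; nra.
  by nra.
have sX0 : 0 < sigma_min X by rewrite XE; apply: sigma_min_gt0.
have rp0 : 0 < Num.sqrt p%:R :> R by rewrite sqrtr_gt0 ltr0n.
(* The shift by 1/2 keeps [tau] positive when the residual vanishes, so the weight [c2] makes sense;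
   the constant 2 in the final bound absorbs it. *)
pose E := vnorm ehat / Num.sqrt p%:R; pose tau := E + 1 / 2.
have E0 : 0 <= E by rewrite divr_ge0 ?vnorm_ge0 // ltW.
have tau0 : 0 < tau by rewrite /tau; lra.
pose e0 := UZ *m (UZ^T *m ehat).
have e0_le : vnorm e0 <= vnorm ehat by rewrite vnorm_orth // vnorm_trorth.
have e1_le : vnorm (ehat - e0) <= vnorm ehat by apply: vnorm_orthC.
have ehatE : vnorm ehat ^+ 2 = p%:R * E ^+ 2.
  by rewrite /E expr_div_n (sqr_sqrtr (ler0n R p)) mulrC divfK // pnatr_eq0 -lt0n.
have UXe0 : UX^T *m e0 = 0 by exact: (tsls_orthogonal_factor y XE TXu ZE UZ1 TZu Nu).
have UZe1 : UZ^T *m (ehat - e0) = 0 by rewrite mulmxBr (mulmxA UZ^T UZ) UZ1 mul1mx subrr.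
pose dev k l (A : 'M[R]_(n, k)) (B : 'M[R]_(n, l)) (w : cs_outcome m n) : R :=
  fro2 (A^T *m ((countsketch w)^T *m countsketch w) *m B - A^T *m B).
have dev_ge0 k l (A : 'M[R]_(n, k)) (B : 'M[R]_(n, l)) w : 0 <= dev k l A B w by exact: fro2_ge0.
(* Inverse squared tolerances: as all terms are nonnegative, Y <= 1 puts every deviation within its
   tolerance. *)
pose c1 := ((2 * eps) ^+ 2)^-1; pose c2 := ((2 * eps * tau) ^+ 2)^-1.
have c1_gt0 : 0 < c1 by rewrite invr_gt0 exprn_gt0 //; lra.
have c2_gt0 : 0 < c2 by rewrite invr_gt0 exprn_gt0 // !mulr_gt0.
pose Y w := c1 * dev _ _ UZ UZ w + c1 * dev _ _ UZ UX w
  + c2 * dev _ _ UZ (ehat - e0) w + c2 * dev _ _ UX e0 w.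
have avgdev k l (A : 'M[R]_(n, k)) (B : 'M[R]_(n, l)) b :
    fro2 A * fro2 B + fro2 (A^T *m B) <= b * (m%:R * (eps ^+ 2 * delta)) ->
    avg (dev k l A B) <= b * (eps ^+ 2 * delta).
  move=> H; apply: le_trans (avg_sketch_fro2 A B m0) _.
  by rewrite ler_pdivrMr // -mulrA [_ * m%:R]mulrC.
(* Source of the size q(q+1): the second moment is at most (q^2 + q) / m. *)
have ZZ : avg (dev _ _ UZ UZ) <= 1 * (eps ^+ 2 * delta).
  apply: avgdev; rewrite mul1r; apply: le_trans m_ge1.
  rewrite (fro2_orth UZ1) natrM -natr1 mulrDr mulr1 lerD2l -[leRHS](fro2_orth UZ1).
  exact: fro2_trorth_mul.
(* Here qp + p <= 2pq. *)
have ZX : avg (dev _ _ UZ UX) <= 1 * (eps ^+ 2 * delta).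
  apply: avgdev; rewrite mul1r; apply: le_trans m_ge2.
  apply: (@le_trans _ _ (q%:R * p%:R + p%:R)).
    rewrite (fro2_orth UZ1) (fro2_orth UX1) lerD2l -[leRHS](fro2_orth UX1).
    exact: fro2_trorth_mul.
  by rewrite -natrM -natrD ler_nat -mulnA mul2n -addnn mulnC leq_add2l leq_pmulr.
(* The exact product vanishes, leaving q |e1|^2 <= qp E^2, which is E^2 / 2 times 2pq. *)
have Ze : avg (dev _ _ UZ (ehat - e0)) <= E ^+ 2 / 2 * (eps ^+ 2 * delta).
  apply: avgdev; rewrite UZe1 !fro2_cV vnorm0 expr0n addr0 fro2_orth //.
  apply: le_trans (ler_wpM2l _ m_ge2); last by rewrite divr_ge0 ?sqr_ge0.
  rewrite !natrM (_ : _ / 2 * _ = q%:R * (p%:R * E ^+ 2)); last by field.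
  by rewrite -ehatE ler_wpM2l // ler_pXn2r ?nnegrE ?vnorm_ge0.
(* Likewise with p |e0|^2, and p <= q brings it to the same bound. *)
have Xe : avg (dev _ _ UX e0) <= E ^+ 2 / 2 * (eps ^+ 2 * delta).
  apply: avgdev; rewrite UXe0 !fro2_cV vnorm0 expr0n addr0 fro2_orth //.
  apply: le_trans (ler_wpM2l _ m_ge2); last by rewrite divr_ge0 ?sqr_ge0.
  rewrite !natrM (_ : _ / 2 * _ = q%:R * (p%:R * E ^+ 2)); last by field.
  rewrite -ehatE; apply: ler_pM; rewrite ?ler0n ?sqr_ge0 ?ler_nat //.
  by rewrite ler_pXn2r ?nnegrE ?vnorm_ge0.
(* The first two terms contribute at most [delta / 4] each, the noise terms at most [delta / 8] each
   because E <= tau. *)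
have avgY : avg Y <= delta.
  have c1E : c1 * (1 * (eps ^+ 2 * delta)) = delta / 4.
    by rewrite /c1; field; rewrite gt_eqF.
  have c2E : c2 * (E ^+ 2 / 2 * (eps ^+ 2 * delta)) <= delta / 8.
    rewrite /c2 mulrC ler_pdivrMr ?exprn_gt0 ?mulr_gt0 //.
    rewrite (_ : delta / 8 * _ = tau ^+ 2 / 2 * (eps ^+ 2 * delta)); last by field.
    rewrite ler_pM2r // ler_pM2r ?invr_gt0 // ler_pXn2r ?nnegrE //; first by rewrite /tau; lra.
    exact: ltW.
  rewrite /Y !avgD !avgZ.
  have := ler_wpM2l (ltW c1_gt0) ZZ; have := ler_wpM2l (ltW c1_gt0) ZX.
  have := ler_wpM2l (ltW c2_gt0) Ze; have := ler_wpM2l (ltW c2_gt0) Xe.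
  lra.
apply: (@le_trans _ _ (1 - avg Y)); first by lra.
apply: markov_compl; first exact: card_cs_gt0.
  by move=> w; rewrite !addr_ge0 // mulr_ge0 // ltW.
move=> w Yw.
have H : [/\ c1 * dev _ _ UZ UZ w <= 1, c1 * dev _ _ UZ UX w <= 1,
   c2 * dev _ _ UZ (ehat - e0) w <= 1 & c2 * dev _ _ UX e0 w <= 1].
  have := mulr_ge0 (ltW c1_gt0) (dev_ge0 _ _ UZ UZ w).
  have := mulr_ge0 (ltW c1_gt0) (dev_ge0 _ _ UZ UX w).
  have := mulr_ge0 (ltW c2_gt0) (dev_ge0 _ _ UZ (ehat - e0) w).
  have := mulr_ge0 (ltW c2_gt0) (dev_ge0 _ _ UX e0 w).
  by move: Yw; rewrite /Y => *; split; lra.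
case: H; rewrite /c1 /c2 !ler_pdivrMl ?mulr1 ?exprn_gt0 ?mulr_gt0 // => H1 H2 H3 H4.
have [Zu Xu main] := sketched_tsls_error XE UX1 TXu ZE UZ1 TZu Nu eps0 s16 s1 (ltW tau0)
  s_le H1 H2 H3 H4.
apply/and3P; split=> //=.
have s0 : 0 < s by lra.
rewrite ler_pdivlMr ?mulr_gt0 ?exprn_gt0 //.
rewrite mulrC mulrAC mulrC; apply: le_trans main _; rewrite -/E.
(* 7 (E + 1/2) <= 4 (2 + 3 E); dividing by 1 - eps then only enlarges the bound. *)
apply: (@le_trans _ _ (4 * eps * (2 + 3 * E))); first by rewrite /tau; nra.
rewrite ler_wpM2r //; first by lra.
by rewrite ler_pdivlMr; nra.
Qed.
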